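(* Let $(w^n)_{n\in\mathbb{N}}$ be a sequence generated by the Iterative Kernel Thresholding Algorithm (IKTA), converging to $\bar w\in H$. Then there exists $N\in\mathbb{N}$ such that $$(\forall n\ge N)\quad \operatorname{supp}(\bar w)\subset\operatorname{supp}(w^n)\subset\operatorname{esupp}(\bar w).$$
   Context: Setting. Let $d,m,G\ge 1$ be integers, $x_1,\dots,x_m\in\mathbb{R}^d$, $y=(y_1,\dots,y_m)\in\mathbb{R}^m$, and $\lambda>0$. Let $H_1,\dots,H_G$ be separable real Hilbert spaces (possibly infinite-dimensional), let $\Phi_g:\mathbb{R}^d\to H_g$ be a map for each $g\in\{1,\dots,G\}$, and let $H=H_1\times\dots\times H_G$ be the product Hilbert space, whose elements are written $w=(w_1,\dots,w_G)$. Convergence in $H$ is in norm. For each $g$, define $X_g:H_g\to\mathbb{R}^m$ by $X_gw_g=(\langle\Phi_g(x_i),w_g\rangle_{H_g})_{i=1}^m$, with adjoint $X_g^*:\mathbb{R}^m\to H_g$, and $K_g:=X_gX_g^*\in\mathbb{R}^{m\times m}$. Let $X:H\to\mathbb{R}^m$, $Xw=\sum_{g=1}^GX_gw_g$. Elements $\alpha\in\mathbb{R}^{m\times G}$ are identified with $(\alpha_1,\dots,\alpha_G)$, $\alpha_g\in\mathbb{R}^m$. Let $K=[K_1,\dots,K_G]$, so that $K\alpha=\sum_{g=1}^GK_g\alpha_g\in\mathbb{R}^m$, and let $\Vert K\Vert$ be its operator norm (with $2\Vert K\Vert^{-1}=+\infty$ if $K=0$). For $\mu>0$, $g\in\{1,\dots,G\}$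 and $\alpha_g\in\mathbb{R}^m$, define the thresholding operator $\widehat{\mathcal{G}}_{\mu,g}(\alpha_g):=0$ if $\Vert X_g^*\alpha_g\Vert_{H_g}\le\mu$, and $\widehat{\mathcal{G}}_{\mu,g}(\alpha_g):=\big(1-\frac{\mu}{\Vert X_g^*\alpha_g\Vert_{H_g}}\big)\alpha_g$ otherwise. Algorithm (IKTA). Given $\alpha^0\in\mathbb{R}^{m\times G}$ and $\tau\in\,]0,2\Vert K\Vert^{-1}[$, for all $n\in\mathbb{N}$ and $g\in\{1,\dots,G\}$, $$\alpha_g^{n+1}=\widehat{\mathcal{G}}_{\lambda\tau,g}\big(\alpha_g^n-\tau(K\alpha^n-y)\big),\qquad w_g^{n+1}=X_g^*\alpha_g^{n+1},$$ with $w_g^0=X_g^*\alpha_g^0$. The (group) support of $w\in H$ is $\operatorname{supp}(w):=\{g\in\{1,\dots,G\}:w_g\ne0\}$. The extended support of $\bar w$ is $\operatorname{esupp}(\bar w):=\{g\in\{1,\dots,G\}:\Vert X_g^*(X\bar w-y)\Vert_{H_g}=\lambda\}$. *)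

(* Defs.v *)
From HB Require Import structures.
From mathcomp Require Import all_boot all_order all_algebra.
From mathcomp Require Import all_classical all_reals all_analysis.

Set Implicit Arguments.
Unset Strict Implicit.
Unset Printing Implicit Defensive.

Import Order.TTheory GRing.Theory Num.Theory.
Import numFieldNormedType.Exports.

Local Open Scope classical_set_scope.
Local Open Scope ring_scope.

(* Completeness and the norm topology come from completeNormedModType; the
   mixin requires the norm to be the one induced by the inner product, which
   also makes [inner] positive definite. *)
HB.mixin Record CompleteNormedModule_isHilbert (R : realType) H
    of CompleteNormedModule R H := {
  inner : H -> H -> R ;
  innerC : forall u v : H, inner u v = inner v u ;
  innerDr : forall u v1 v2 : H, inner u (v1 + v2) = inner u v1 + inner u v2 ;
  innerZr : forall (c : R) (u v : H), inner u (c *: v) = c * inner u v ;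
  inner_normE : forall u : H, inner u u = `|u| ^+ 2
}.

#[short(type="hilbertType")]
HB.structure Definition Hilbert (R : realType) :=
  {H of CompleteNormedModule_isHilbert R H & CompleteNormedModule R H}.

Section InnerInstances.
Context (R : realType) (H : hilbertType R).

Let inner_bilinear :
  bilinear_for *%R (@idfun R \; *%R) (@inner R H : H -> H -> R).
Proof.
split=> [v c u1 u2|u c v1 v2] /=; last by rewrite innerDr innerZr.
by rewrite ![inner _ v]innerC innerDr innerZr.
Qed.

HB.instance Definition _ := bilinear_isBilinear.Build R H H R *%R
  (@idfun R \; *%R) (@inner R H) inner_bilinear.

Let inner_herm (u v : H) :
  inner u v = (-1) ^+ false * @idfun R (inner v u).
Proof. by rewrite expr0 mul1r innerC. Qed.

HB.instance Definition _ := isHermitianSesquilinear.Build R H false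
  (@idfun R) (@inner R H) inner_herm.

Let inner_gt0 (u : H) : u != 0 -> 0 < inner u u.
Proof. by move=> u0; rewrite inner_normE exprn_gt0 // normr_gt0. Qed.

HB.instance Definition _ := isDotProduct.Build R H (@inner R H) inner_gt0.

End InnerInstances.

Definition separable (T : topologicalType) : Prop :=
  exists2 A : set T, countable A & dense A.

(* The library norm on matrices is the sup norm; the norms on R^m and on
   R^(m x G) used here are Euclidean. *)
Definition mxdot (R : realType) (p q : nat) (A B : 'M[R]_(p, q)) : R :=
  \sum_i \sum_j A i j * B i j.

Definition mxnorm (R : realType) (p q : nat) (A : 'M[R]_(p, q)) : R :=
  Num.sqrt (mxdot A A).

Definition opnorm (R : realType) (p q r s : nat)
    (f : 'M[R]_(p, q) -> 'M[R]_(r, s)) : R :=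
  sup [set mxnorm (f A) | A in [set A | mxnorm A <= 1]].

(* [adjoint T a] is the vector u such that <T w, a> = <w, u> for all w; see
   [adjointP] for its existence and uniqueness in the case used below. *)
Definition adjoint (R : realType) (H : hilbertType R) (m : nat)
    (T : H -> 'cV[R]_m) (a : 'cV[R]_m) : H :=
  xget 0 [set u | forall w : H, mxdot (T w) a = inner w u].

Section GroupKernel.
Context (R : realType) (d m G : nat) (H : 'I_G -> hilbertType R).
Context (x : 'I_m -> 'rV[R]_d) (Phi : forall g : 'I_G, 'rV[R]_d -> H g).

Definition Xg (g : 'I_G) (w : H g) : 'cV[R]_m :=
  \col_i inner (Phi g (x i)) w.

Definition Xgadj (g : 'I_G) : 'cV[R]_m -> H g := adjoint (@Xg g).

Definition X (w : forall g : 'I_G, H g) : 'cV[R]_m := \sum_g Xg (w g).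

(* Matrix of X_g X_g^* in the canonical basis. *)
Definition Kg (g : 'I_G) : 'M[R]_m :=
  \matrix_(i, j) Xg (Xgadj g (delta_mx j 0)) i 0.

(* The g-th column of alpha is alpha_g. *)
Definition K (alpha : 'M[R]_(m, G)) : 'cV[R]_m :=
  \sum_g Kg g *m col g alpha.

(* 2 ||K||^-1, equal to +oo when K = 0. *)
Definition step_bound : \bar R :=
  if [forall g, Kg g == 0] then +oo%E else (2 * (opnorm K)^-1)%:E.

Definition threshold (mu : R) (g : 'I_G) (a : 'cV[R]_m) : 'cV[R]_m :=
  if `|Xgadj g a| <= mu then 0 else (1 - mu / `|Xgadj g a|) *: a.

Definition IKTA (y : 'cV[R]_m) (lambda tau : R) (alpha0 : 'M[R]_(m, G))
    (alpha : nat -> 'M[R]_(m, G)) (w : nat -> forall g : 'I_G, H g) : Prop :=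
  [/\ alpha 0%N = alpha0,
      forall n g, col g (alpha n.+1) =
        threshold (lambda * tau) g
          (col g (alpha n) - tau *: (K (alpha n) - y)),
      forall g, w 0%N g = Xgadj g (col g alpha0)
    & forall n g, w n.+1 g = Xgadj g (col g (alpha n.+1))].

Definition prodnorm (w : forall g : 'I_G, H g) : R :=
  Num.sqrt (\sum_g `|w g| ^+ 2).

(* Norm convergence in the Hilbert product of the H g. *)
Definition prodcvg (w : nat -> forall g : 'I_G, H g)
    (wbar : forall g : 'I_G, H g) : Prop :=
  prodnorm (fun g => w n g - wbar g) @[n --> \oo] --> (0 : R).

Definition supp (w : forall g : 'I_G, H g) : set 'I_G := [set g | w g != 0].

Definition esupp (y : 'cV[R]_m) (lambda : R) (wbar : forall g : 'I_G, H g) :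
    set 'I_G :=
  [set g | `|Xgadj g (X wbar - y)| = lambda].

Let inner_sumZ (g : 'I_G) (a : 'cV[R]_m) (w : H g) :
  mxdot (Xg w) a = inner w (\sum_i a i 0 *: Phi g (x i)).
Proof.
rewrite linear_sumr /=; apply: eq_bigr => i _.
by rewrite big_ord_recl big_ord0 addr0 mxE innerZr mulrC innerC.
Qed.

Lemma adjointP (g : 'I_G) (a : 'cV[R]_m) (u : H g) :
  (forall w : H g, mxdot (Xg w) a = inner w u) <-> u = Xgadj g a.
Proof.
have uniq (u1 u2 : H g) : (forall w : H g, mxdot (Xg w) a = inner w u1) ->
    (forall w : H g, mxdot (Xg w) a = inner w u2) -> u1 = u2.
  move=> h1 h2; apply/eqP; rewrite -subr_eq0 -normr_eq0 -sqrf_eq0 -inner_normE.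
  by rewrite linearBr /= -h1 -h2 subrr.
rewrite /Xgadj /adjoint; case: xgetP => [v _ hv|].
  by split=> [hu|->//]; apply: uniq.
by move=> /(_ (\sum_i a i 0 *: Phi g (x i)))[]; exact: inner_sumZ.
Qed.

Lemma XgadjE (g : 'I_G) (a : 'cV[R]_m) :
  Xgadj g a = \sum_i a i 0 *: Phi g (x i).
Proof. exact/esym/adjointP/inner_sumZ. Qed.

Lemma KgE (g : 'I_G) (a : 'cV[R]_m) : Kg g *m a = Xg (Xgadj g a).
Proof.
apply/colP => i; rewrite !mxE XgadjE linear_sumr /=; apply: eq_bigr => j _.
rewrite innerZr !mxE mulrC; congr (_ * inner _ _).
rewrite XgadjE (bigD1 j)//= mxE !eqxx scale1r big1 ?addr0// => k kj.
by rewrite mxE (negPf kj) scale0r.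
Qed.

End GroupKernel.

(* Main.v *)
(** Put [v n g = w n g - tau *: Xg^*(X (w n) - y)] and [mu = lambda * tau]. Then
    [w n.+1 g] is the soft-thresholding of [v n g] at level [mu], so
    [`|v n g - w n.+1 g| = min `|v n g| mu]. With [vbar] the limit of [v],
    [tau * `|Xg^*(X wbar - y)| = min `|vbar g| mu]. Either [`|vbar g| < mu], and
    then [w n.+1 g = 0] for all large n, or the minimum is [mu], and then g
    belongs to the extended support. The first inclusion only uses that
    [wbar g != 0] is an open condition. *)
Require Import Defs.
From HB Require Import structures.
From mathcomp Require Import all_boot all_order all_algebra.
From mathcomp Require Import all_classical all_reals all_analysis.
From mathcomp Require Import ring.

Set Implicit Arguments.
Unset Strict Implicit.
Unset Printing Implicit Defensive.

Import Order.TTheory GRing.Theory Num.Theory.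
Import numFieldNormedType.Exports.

Local Open Scope classical_set_scope.
Local Open Scope ring_scope.

Section Inner.
Context (R : realType) (H : hilbertType R).

(** Reduces the continuity of [inner u] to that of the norm. *)
Lemma inner_polarization (u v : H) :
  inner u v = (`|u + v| ^+ 2 - `|u| ^+ 2 - `|v| ^+ 2) / 2.
Proof.
rewrite -!inner_normE innerDr ![inner (u + v) _]innerC !innerDr (innerC v u).
by field.
Qed.

Lemma cvg_inner (u : H) (v : nat -> H) (l : H) :
  v n @[n --> \oo] --> l -> inner u (v n) @[n --> \oo] --> inner u l.
Proof.
move=> vl; under eq_fun do rewrite inner_polarization.
rewrite inner_polarization; apply: cvgM; last exact: cvg_cst.
by apply: cvgB; [apply: cvgB; [|exact: cvg_cst]|];
  rewrite expr2; under eq_fun do rewrite expr2;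
  apply: cvgM; apply: cvg_norm => //; apply: cvgD => //; exact: cvg_cst.
Qed.

End Inner.

(** The square of each component's norm is one term of the nonnegative sum under the root, so
    [prodnorm] dominates it. *)
Lemma prodcvg_proj (R : realType) (G : nat) (H : 'I_G -> hilbertType R)
    (w : nat -> forall g : 'I_G, H g) (wbar : forall g : 'I_G, H g) :
  prodcvg w wbar -> forall g, w n g @[n --> \oo] --> wbar g.
Proof.
move=> wcvg g; have norm0 : `|w n g - wbar g| @[n --> \oo] --> (0 : R).
  apply: (@squeeze_cvgr _ _ _ _ _ _ _ _ _ (cvg_cst _) wcvg); near=> n.
  rewrite normr_ge0/= /prodnorm -(ger0_norm (normr_ge0 _)) -sqrtr_sqr ler_sqrt.
    by rewrite (bigD1 g)//= lerDl sumr_ge0// => i _; exact: sqr_ge0.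
  by apply: sumr_ge0 => i _; exact: sqr_ge0.
by apply/subr_cvg0; exact: norm_cvg0.
Unshelve. all: by end_near. Qed.

Section Kernel.
Context (R : realType) (d m G : nat) (H : 'I_G -> hilbertType R).
Context (x : 'I_m -> 'rV[R]_d) (Phi : forall g : 'I_G, 'rV[R]_d -> H g).

Lemma XgadjB (g : 'I_G) (a b : 'cV[R]_m) :
  Xgadj x Phi g (a - b) = Xgadj x Phi g a - Xgadj x Phi g b.
Proof.
rewrite !XgadjE -sumrB; apply: eq_bigr => i _.
by rewrite !mxE scalerBl.
Qed.

Lemma XgadjZ (g : 'I_G) (c : R) (a : 'cV[R]_m) :
  Xgadj x Phi g (c *: a) = c *: Xgadj x Phi g a.
Proof.
rewrite !XgadjE scaler_sumr; apply: eq_bigr => i _.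
by rewrite mxE scalerA.
Qed.

Lemma Xgadj0 (g : 'I_G) : Xgadj x Phi g 0 = 0.
Proof. by rewrite -(subrr (0 : 'cV_m)) XgadjB subrr. Qed.

(** What thresholding removes from [Xgadj x Phi g a] is its projection onto the ball of radius [mu]:
    the whole vector inside the ball, its rescaling to norm [mu] outside. *)
Lemma norm_Xgadj_subr_threshold (mu : R) (g : 'I_G) (a : 'cV[R]_m) : 0 < mu ->
  `|Xgadj x Phi g a - Xgadj x Phi g (threshold x Phi mu g a)|
    = Num.min `|Xgadj x Phi g a| mu.
Proof.
move=> mu0; rewrite /threshold; case: ifPn => [le_mu|].
  by rewrite Xgadj0 subr0 min_l.
rewrite -ltNge => lt_mu; rewrite XgadjZ scalerBl scale1r opprB addrC subrK.
rewrite normrZ normrM normfV normr_id (gtr0_norm mu0).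
by rewrite divfK ?min_r 1?ltW// gt_eqF// (lt_trans mu0).
Qed.

(** The residual is a finite combination of the fixed vectors [Phi g (x i)], whose coefficients are
    finite sums of inner products with fixed vectors, up to a constant. *)
Lemma cvg_Xgadj_residual (y : 'cV[R]_m) (w : nat -> forall g : 'I_G, H g)
    (wbar : forall g : 'I_G, H g) :
  (forall g, w n g @[n --> \oo] --> wbar g) -> forall g,
  Xgadj x Phi g (X x Phi (w n) - y) @[n --> \oo]
    --> Xgadj x Phi g (X x Phi wbar - y).
Proof.
move=> wcvg g; under eq_fun do rewrite XgadjE.
rewrite XgadjE; apply: cvg_big => [|i _]; first exact: add_continuous.
apply: cvgZr_tmp.
have XE v : (X x Phi v - y) i 0 = \sum_g inner (Phi g (x i)) (v g) - y i 0.
  by rewrite !mxE summxE; congr (_ - _); apply: eq_bigr => h _; rewrite mxE.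
under eq_fun do rewrite XE.
rewrite XE; apply: cvgB; last exact: cvg_cst.
by apply: cvg_big => [|h _]; [exact: add_continuous|exact: cvg_inner].
Qed.

Lemma IKTA_Xgadj (y : 'cV[R]_m) (lambda tau : R) (alpha0 : 'M[R]_(m, G))
    (alpha : nat -> 'M[R]_(m, G)) (w : nat -> forall g : 'I_G, H g) :
  IKTA x Phi y lambda tau alpha0 alpha w ->
  forall n g, w n g = Xgadj x Phi g (col g (alpha n)).
Proof. by case=> a0 _ w0 wS [|n] g; rewrite ?w0 ?a0 ?wS. Qed.

(** Lets the iteration on the coefficients be read as one on [w]. *)
Lemma K_X (alpha : 'M[R]_(m, G)) (w : forall g : 'I_G, H g) :
  (forall g, w g = Xgadj x Phi g (col g alpha)) -> K x Phi alpha = X x Phi w.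
Proof. by move=> wE; apply: eq_bigr => g _; rewrite KgE wE. Qed.

End Kernel.

Theorem theorem2 (R : realType) (d m G : nat)
    (d_gt0 : (0 < d)%N) (m_gt0 : (0 < m)%N) (G_gt0 : (0 < G)%N)
    (H : 'I_G -> hilbertType R) (H_sep : forall g : 'I_G, separable (H g))
    (x : 'I_m -> 'rV[R]_d) (y : 'cV[R]_m)
    (Phi : forall g : 'I_G, 'rV[R]_d -> H g)
    (lambda : R) (lambda_gt0 : 0 < lambda)
    (tau : R) (tau_gt0 : 0 < tau) (tau_lt : (tau%:E < step_bound x Phi)%E)
    (alpha0 : 'M[R]_(m, G)) (alpha : nat -> 'M[R]_(m, G))
    (w : nat -> forall g : 'I_G, H g)
    (w_IKTA : IKTA x Phi y lambda tau alpha0 alpha w)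
    (wbar : forall g : 'I_G, H g) (w_cvg : prodcvg w wbar) :
  exists N : nat, forall n : nat, (N <= n)%N ->
    supp wbar `<=` supp (w n) /\ supp (w n) `<=` esupp x Phi y lambda wbar.
Proof.
have wg_cvg := prodcvg_proj w_cvg.
have mu_gt0 : 0 < lambda * tau by rewrite mulr_gt0.
have wE := IKTA_Xgadj w_IKTA; case: w_IKTA => _ alphaS _ _.
pose r (v : forall g, H g) g := Xgadj x Phi g (X x Phi v - y).
pose a n g := col g (alpha n) - tau *: (K x Phi (alpha n) - y).
(* A gradient step for the least-squares term, taken at [w n]. *)
have aE n g : Xgadj x Phi g (a n g) = w n g - tau *: r (w n) g.
  by rewrite /a XgadjB XgadjZ -wE (K_X (wE n)).
have a_cvg g : Xgadj x Phi g (a n g) @[n --> \oo] --> wbar g - tau *: r wbar g.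
  under eq_fun do rewrite aE.
  apply: cvgB; first exact: wg_cvg.
  by apply: cvgZl_tmp; apply: cvg_Xgadj_residual; exact: wg_cvg.
(* Both sides are limits of the gap between the gradient step and its thresholding, so they agree by
   uniqueness of the limit. *)
have minE g :
    tau * `|r wbar g| = Num.min `|wbar g - tau *: r wbar g| (lambda * tau).
  have gapE n : `|Xgadj x Phi g (a n g) - w n.+1 g|
      = Num.min `|Xgadj x Phi g (a n g)| (lambda * tau).
    by rewrite wE alphaS norm_Xgadj_subr_threshold.
  have gap_cvg : `|Xgadj x Phi g (a n g) - w n.+1 g| @[n --> \oo]
      --> tau * `|r wbar g|.
    have -> : tau * `|r wbar g| = `|wbar g - tau *: r wbar g - wbar g|.
      by rewrite addrAC subrr add0r normrN normrZ gtr0_norm.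
    apply: cvg_norm; apply: cvgB; first exact: a_cvg.
    by move: (wg_cvg g); rewrite -cvg_shiftS.
  apply: (cvg_unique _ gap_cvg) => //; rewrite (funext gapE).
  apply: (@continuous_cvg _ _ _ _ _ _ (Num.min^~ (lambda * tau))).
    by apply: continuous_min => //; exact: cst_continuous.
  by apply: cvg_norm; exact: a_cvg.
have near_supp g : \forall n \near \oo, wbar g != 0 -> w n g != 0.
  have [_|wg0] := eqVneq (wbar g) 0; first exact: nearW.
  by near=> n => _; near: n; exact: cvgr_neq0 (wg_cvg g) wg0.
have near_esupp g : \forall n \near \oo, w n g != 0 -> `|r wbar g| = lambda.
  have [lt_mu|ge_mu] := ltP `|wbar g - tau *: r wbar g| (lambda * tau).
    (* Thresholding at step [n] acts on the iterate of index [n.+1], hence the shift. *)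
    apply: near_inftyS; near=> n.
    have le_mu : `|Xgadj x Phi g (a n g)| <= lambda * tau.
      by near: n; exact: cvgr_norm_le (a_cvg g) _ lt_mu.
    rewrite wE alphaS -/(a n g) /threshold le_mu.
    by rewrite Xgadj0 eqxx.
  (* Here the minimum in [minE] is [lambda * tau], and cancelling [tau] gives the equality for every
     [n]. *)
  apply: nearW => n _; apply: (mulfI (lt0r_neq0 tau_gt0)).
  by rewrite minE min_r// mulrC.
(* There are finitely many groups, so one rank serves them all. *)
have [N _ hN] : \forall n \near \oo, forall g : 'I_G,
    (wbar g != 0 -> w n g != 0) /\ (w n g != 0 -> `|r wbar g| = lambda).
  by apply: filter_forall => g; near=> n; split; near: n;
    [exact: near_supp|exact: near_esupp].
by exists N => n /hN hn; split=> g; have [] := hn g.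
Unshelve. all: by end_near. Qed.
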